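(* Let $d$ be a metric on a finite set $X$, let $q>0$, and let $c\in\mathbb R^X$ satisfy $\sum_x c_x=0$. For $p\in X$, define $T_pc=T_p^dc\in\mathbb R^X$ by \[ (T_pc)_x=c_x\,d(x,p)^q\quad(x\ne p),\qquad (T_pc)_p=-\Phi_c(p). \] Then \[ \sum_x (T_pc)_x=0 \qquad\text{and}\qquad \mathcal Q_q(d^{(p)};T_pc)=\mathcal Q_q(d;c). \] If $c_p\Phi_c(p)>0$, then the sign of the coefficient at $p$ is reversed by $T_p$, while the sign of every other nonzero coefficient is preserved. Moreover, if $c'=T_pc$ and $d'=d^{(p)}$, then \[ \Phi_{c'}^{d'}(p)=-c_p, \] \[ \Phi_{c'}^{d'}(x)=\frac{\Phi_c^d(x)-\Phi_c^d(p)-c_p\,d(x,p)^q}{d(x,p)^q}\qquad(x\ne p), \] and transport is involutive: \[ T_p^{d'}(T_p^{d}c)=c. \]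
   Context: For a metric $d$ on a finite set $X$ and $p\in X$, the metric inversion at $p$ is the function $d^{(p)}$ on $X\times X$ with $d^{(p)}(p,p)=0$, $d^{(p)}(p,x)=d^{(p)}(x,p)=1/d(p,x)$ for $x\ne p$, and $d^{(p)}(x,y)=\dfrac{d(x,y)}{d(x,p)d(y,p)}$ for $x,y\ne p$. For such a function $d$ (a metric or its inversion), and $c\in\mathbb R^X$ with zero sum, \[ \mathcal Q_q(d;c)=\sum_{x,y\in X}c_xc_y\,d(x,y)^q,\qquad \Phi_c(x)=\Phi_c^d(x)=\sum_{y\in X}c_y\,d(x,y)^q. \] The operator $T_p^{d'}$ is defined by the same formula as $T_p^d$, with $d'$ and $\Phi^{d'}$ in place of $d$ and $\Phi^d$. *)

(* Defs.v *)
From mathcomp Require Export all_boot all_order all_algebra.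
From mathcomp Require Export reals exp.

Set Implicit Arguments.
Unset Strict Implicit.
Unset Printing Implicit Defensive.

Import Order.TTheory GRing.Theory Num.Theory.
Local Open Scope ring_scope.

(* The library's [metricType] attaches a single distance to a carrier, whereas
   here several distances live on the same finite set; hence a predicate. *)
Record is_metric (R : realType) (X : finType) (d : X -> X -> R) : Prop :=
  IsMetric {
    metric_ge0 : forall x y, 0 <= d x y;
    metric_eq0 : forall x y, d x y = 0 <-> x = y;
    metric_sym : forall x y, d x y = d y x;
    metric_triangle : forall x y z, d x z <= d x y + d y z }.

Definition inversion (R : realType) (X : finType) (d : X -> X -> R) (p : X)
    (x y : X) : R :=
  if x == p then (if y == p then 0 else (d p y)^-1)
  else if y == p then (d p x)^-1
  else d x y / (d x p * d y p).

(* [a `^ q] is the real power; for q != 0 the library has [0 `^ q = 0], so the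
   diagonal terms below vanish when q > 0. *)
Definition energy (R : realType) (X : finType) (q : R) (d : X -> X -> R)
    (c : {ffun X -> R}) : R :=
  \sum_x \sum_y c x * c y * d x y `^ q.

Definition potential (R : realType) (X : finType) (q : R) (d : X -> X -> R)
    (c : {ffun X -> R}) (x : X) : R :=
  \sum_y c y * d x y `^ q.

Definition transport (R : realType) (X : finType) (q : R) (d : X -> X -> R)
    (p : X) (c : {ffun X -> R}) : {ffun X -> R} :=
  [ffun x => if x == p then - potential q d c p else c x * d x p `^ q].

(* Main.v *)
(* Off the pole p, the inverted kernel is the conjugate of d^q by the weights
   d(., p)^-q; these weights cancel against those in T_p c, so each potential
   of T_p c is an affine expression in those of c.  The energy is the sum of
   c_x Phi_c(x), and there sum_x c_x = 0 makes the correction terms cancel. *)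
Require Import Defs.
From mathcomp Require Import all_boot all_order all_algebra reals exp.
From mathcomp Require Import ring.

Set Implicit Arguments.
Unset Strict Implicit.
Unset Printing Implicit Defensive.

Import Order.TTheory GRing.Theory Num.Theory.
Local Open Scope ring_scope.

(** Inversion is the power of exponent -1, and iterated exponents commute. *)
Lemma powR_inv (R : realType) (a q : R) : 0 <= a -> a^-1 `^ q = (a `^ q)^-1.
Proof. by move=> a0; rewrite -powR_inv1// -!powRrM mulrC powRrM powR_inv1 ?powR_ge0. Qed.

Section Transport.
Variables (R : realType) (X : finType) (d : X -> X -> R) (q : R).
Variables (c : {ffun X -> R}) (p : X).
Hypotheses (hd : is_metric d) (hq : 0 < q).

Lemma metric_powR_gt0 x y : x != y -> 0 < d x y `^ q.
Proof.
move=> xy; rewrite powR_gt0// lt_def metric_ge0// andbT.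
by apply: contra_neq xy => /(metric_eq0 hd).
Qed.

(** Strict positivity of [q] matters here: the zeroth power of 0 is 1. *)
Lemma metric_powRxx x : d x x `^ q = 0.
Proof. by rewrite (metric_eq0 hd x x).2// powR0// gt_eqF. Qed.

Lemma inversion_powRxx : inversion d p p p `^ q = 0.
Proof. by rewrite /inversion eqxx powR0// gt_eqF. Qed.

Lemma inversion_powRl x : x != p -> inversion d p p x `^ q = (d x p `^ q)^-1.
Proof.
move=> /negPf xp.
by rewrite /inversion eqxx xp powR_inv ?metric_ge0// (metric_sym hd p).
Qed.

Lemma inversion_powRr x : x != p -> inversion d p x p `^ q = (d x p `^ q)^-1.
Proof.
move=> /negPf xp.
by rewrite /inversion xp eqxx powR_inv ?metric_ge0// (metric_sym hd p).
Qed.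

(** The case [x = y] is included, so sums off the pole need no separate diagonal term. *)
Lemma inversion_powR x y : x != p -> y != p ->
  inversion d p x y `^ q = d x y `^ q / (d x p `^ q * d y p `^ q).
Proof.
move=> /negPf xp /negPf yp; rewrite /inversion xp yp.
by rewrite powRM ?invr_ge0 ?mulr_ge0 ?metric_ge0// powR_inv
  ?powRM ?mulr_ge0 ?metric_ge0.
Qed.

Lemma potential_inversion_transport_pole : \sum_x c x = 0 ->
  potential q (inversion d p) (transport q d p c) p = - c p.
Proof.
(* The zero-sum hypothesis turns [- c p] into the sum of [c] off the pole, which is then matched
   term by term. *)
rewrite (bigD1 p)//= addrC => /eqP; rewrite addr_eq0 => /eqP <-.
rewrite /potential (bigD1 p)//= inversion_powRxx mulr0 add0r.
apply: eq_bigr => x xp.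
by rewrite ffunE (negPf xp) inversion_powRl// mulfK// gt_eqF ?metric_powR_gt0.
Qed.

Lemma potential_inversion_transport x : x != p ->
  potential q (inversion d p) (transport q d p c) x =
    (potential q d c x - potential q d c p - c p * d x p `^ q) / d x p `^ q.
Proof.
move=> xp.
have -> : potential q d c x
    = c p * d x p `^ q + \sum_(y | y != p) c y * d x y `^ q.
  by rewrite /potential (bigD1 p).
rewrite {1}/potential (bigD1 p)//= ffunE eqxx inversion_powRr// mulNr.
rewrite [c p * _ + _]addrC addrAC addrK mulrBl addrC; congr (_ - _).
rewrite mulr_suml; apply: eq_bigr => y yp.
rewrite ffunE (negPf yp) inversion_powR//.
have := metric_powR_gt0 xp; have := metric_powR_gt0 yp.
by move=> /lt0r_neq0 y0 /lt0r_neq0 x0; field; rewrite x0 y0.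
Qed.

(** The coefficient at [p] is chosen to balance the others: its own term in the potential at [p]
    vanishes, and the rest are the transported coefficients. *)
Lemma sum_transport : \sum_x transport q d p c x = 0.
Proof.
rewrite (bigD1 p)//= ffunE eqxx /potential (bigD1 p)//= metric_powRxx mulr0 add0r.
apply/eqP; rewrite addrC subr_eq0; apply/eqP/eq_bigr => x xp.
by rewrite ffunE (negPf xp) (metric_sym hd).
Qed.

(** The kernel is arbitrary, so that this serves both [d] and its inversion. *)
Lemma energy_potential (d' : X -> X -> R) (b : {ffun X -> R}) :
  energy q d' b = \sum_x b x * potential q d' b x.
Proof.
apply: eq_bigr => x _; rewrite mulr_sumr.
by apply: eq_bigr => y _; rewrite mulrA.
Qed.

Lemma energy_inversion_transport : \sum_x c x = 0 ->
  energy q (inversion d p) (transport q d p c) = energy q d c.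
Proof.
move=> c0; rewrite !energy_potential.
rewrite (bigD1 p)//= [RHS](bigD1 p)//=.
rewrite potential_inversion_transport_pole// ffunE eqxx mulrNN mulrC.
(* The pole terms agree: transport swaps the coefficient and the potential at [p], up to two signs
   that cancel. *)
congr (_ + _).
transitivity (\sum_(x | x != p) (c x * potential q d c x
    - c x * potential q d c p - c p * (c x * d p x `^ q))).
  apply: eq_bigr => x xp.
  rewrite potential_inversion_transport// ffunE (negPf xp) (metric_sym hd p).
  by have /lt0r_neq0 x0 := metric_powR_gt0 xp; field.
(* The two corrections become [c p * potential q d c p] with opposite signs. *)
rewrite !sumrB -mulr_suml -mulr_sumr.
have -> : \sum_(x | x != p) c x = - c p.
  by apply/eqP; rewrite -addr_eq0 addrC -[eqbRHS]c0 [eqbRHS](bigD1 p).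
have -> : \sum_(x | x != p) c x * d p x `^ q = potential q d c p.
  by rewrite /potential [RHS](bigD1 p)//= metric_powRxx mulr0 add0r.
by ring.
Qed.

(** At the pole the two sign changes cancel; elsewhere the two weights are mutually inverse. *)
Lemma transport_involutive : \sum_x c x = 0 ->
  transport q (inversion d p) p (transport q d p c) = c.
Proof.
move=> c0; apply/ffunP => x; rewrite ffunE.
have [->|xp] := eqVneq x p.
  by rewrite potential_inversion_transport_pole// opprK.
rewrite ffunE (negPf xp) inversion_powRr// mulfK//.
by rewrite gt_eqF ?metric_powR_gt0.
Qed.

(** A positive product forces [c p] and the potential at [p] to share a nonzero sign, and transport
    negates the latter. *)
Lemma sg_transport_pole : 0 < c p * potential q d c p ->
  Num.sg (transport q d p c p) = - Num.sg (c p).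
Proof.
rewrite ffunE eqxx sgrN; set a := c p; set b := potential _ _ _ _ => ab.
congr (- _); have [a0|a0|a0] := ltgtP a 0.
- by rewrite !ltr0_sg// -(nmulr_rgt0 _ a0).
- by rewrite !gtr0_sg// -(pmulr_rgt0 _ a0).
- by rewrite a0 mul0r ltxx in ab.
Qed.

Lemma sg_transport x : x != p -> Num.sg (transport q d p c x) = Num.sg (c x).
Proof.
by move=> xp; rewrite ffunE (negPf xp) sgrM (gtr0_sg (metric_powR_gt0 xp)) mulr1.
Qed.

End Transport.

Theorem theorem8p1 (R : realType) (X : finType) (d : X -> X -> R) (q : R)
    (c : {ffun X -> R}) (hd : is_metric d) (hq : 0 < q)
    (hc : \sum_x c x = 0) (p : X) :
  let d' := inversion d p in
  let c' := transport q d p c in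
  [/\ \sum_x c' x = 0 /\ energy q d' c' = energy q d c,
      0 < c p * potential q d c p ->
        Num.sg (c' p) = - Num.sg (c p) /\
        (forall x, x != p -> c x != 0 -> Num.sg (c' x) = Num.sg (c x)),
      potential q d' c' p = - c p,
      (forall x, x != p ->
        potential q d' c' x =
          (potential q d c x - potential q d c p - c p * d x p `^ q)
            / d x p `^ q) &
      transport q d' p c' = c].
Proof.
split.
- by split; [exact: sum_transport | exact: energy_inversion_transport].
- by move=> cp; split=> [|x xp _]; [exact: sg_transport_pole | exact: sg_transport].
- exact: potential_inversion_transport_pole.
- by move=> x; exact: potential_inversion_transport.
- exact: transport_involutive.
Qed.
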